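(* Let $G=(V,(E_i)_{i\in[k]})$ be a multilayer network with positive edge weights $w_i\colon E_i\to\mathbb{R}_{>0}$ $(i\in[k])$, and let $\bm{\alpha}\in\mathbb{R}_{\ge 0}^k$ and $\bm{\beta}\in\mathbb{R}^k$. Let $\ell^*\in\mathbb{R}$ be a lower bound on the optimal value of $(\bm{\alpha},\bm{\beta})$-DENSITY. Then any vertex $v^*\in V$ that satisfies $\max_{i\in[k]}[\alpha_i\cdot d_i(v^* )+\beta_i]<\ell^*$ is not contained in any subset in the support of any optimal solution to $(\bm{\alpha},\bm{\beta})$-DENSITY.
   Context: Notation: $[k]=\{1,\dots,k\}$ with $k\ge 1$. A multilayer network $G=(V,(E_i)_{i\in[k]})$ consists of a finite nonempty vertex set $V$ and, for each layer $i\in[k]$, a set $E_i$ of undirected edges $\{u,v\}$ ($u\neq v$, $u,v\in V$). For $S\subseteq V$, $E_i[S]=\{\{u,v\}\in E_i\mid u,v\in S\}$ and $w_i(S)=\sum_{e\in E_i[S]}w_i(e)$. The density of $S$ in layer $i$ is $w_i(S)/|S|$, with the convention that it is $0$ for $S=\emptyset$. For $v\in V$ and $i\in[k]$, $d_i(v)=\sum_{e\in E_i:\,v\in e}w_i(e)$ is the weighted degree of $v$ in layer $i$. $\Delta(2^V)$ is the set of probability distributions on $2^V$; for $p\in\Delta(2^V)$, $p_S$ is the probability of $S\subseteq V$, and the support of $p$ is $\mathrm{supp}(p)=\{S\subseteq V\mid p_S>0\}$. Problem $(\bm{\alpha},\bm{\beta})$-DENSITY: find $p\in\Delta(2^V)$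 maximizing $\min_{i\in[k]}\mathbb{E}_{S\sim p}\bigl[\alpha_i\frac{w_i(S)}{|S|}+\beta_i\bigr]=\min_{i\in[k]}\bigl[\alpha_i\sum_{S\subseteq V}p_S\frac{w_i(S)}{|S|}+\beta_i\bigr]$. Its optimal value is the maximum of this quantity over $p\in\Delta(2^V)$. *)

(* Defs.v *)
From mathcomp Require Import all_boot all_order all_algebra.
From mathcomp Require Import reals.

Set Implicit Arguments.
Unset Strict Implicit.
Unset Printing Implicit Defensive.

Import Order.TTheory GRing.Theory Num.Theory.
Local Open Scope ring_scope.

(* An undirected edge {u, v} with u != v is a two-element set of vertices. *)
Record network (V : finType) (k : nat) := Network {
  edges : 'I_k -> {set {set V}};
  edges_card2 : forall i e, e \in edges i -> #|e| = 2%N;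
  vertices_gt0 : (0 < #|V|)%N;
  layers_gt0 : (0 < k)%N
}.

Section Network.
Variables (R : realType) (V : finType) (k : nat) (G : network V k).

(* Min and max of a nonempty family: the default value of the iterated
   operation is the member of the family in the first layer. *)
Definition layer_min (f : 'I_k -> R) : R :=
  \big[Num.min/f (Ordinal (layers_gt0 G))]_(i < k) f i.

Definition layer_max (f : 'I_k -> R) : R :=
  \big[Num.max/f (Ordinal (layers_gt0 G))]_(i < k) f i.

Definition induced_edges (i : 'I_k) (S : {set V}) : {set {set V}} :=
  [set e in edges G i | e \subset S].

(* The weights of layer i are given by a total function w i on {set V}; only
   its values on the edges of layer i are ever used. *)
Implicit Type w : 'I_k -> {set V} -> R.

Definition positive_weights w : Prop :=
  forall i e, e \in edges G i -> 0 < w i e.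

Definition weight w (i : 'I_k) (S : {set V}) : R :=
  \sum_(e in induced_edges i S) w i e.

(* For S = set0 this is 0, since 0^-1 = 0. *)
Definition density w (i : 'I_k) (S : {set V}) : R :=
  weight w i S / #|S|%:R.

Definition degree w (i : 'I_k) (v : V) : R :=
  \sum_(e in edges G i | v \in e) w i e.

Definition distribution (p : {ffun {set V} -> R}) : Prop :=
  (forall S, 0 <= p S) /\ \sum_S p S = 1.

Definition supp (p : {ffun {set V} -> R}) : {set {set V}} :=
  [set S | 0 < p S].

Definition expectation (p : {ffun {set V} -> R}) (f : {set V} -> R) : R :=
  \sum_S p S * f S.

Definition objective w (alpha beta : 'I_k -> R) (p : {ffun {set V} -> R}) : R :=
  layer_min (fun i =>
    expectation p (fun S => alpha i * density w i S + beta i)).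

Definition optimal_solution w (alpha beta : 'I_k -> R)
    (p : {ffun {set V} -> R}) : Prop :=
  distribution p /\
  forall q, distribution q -> objective w alpha beta q <= objective w alpha beta p.

Definition optimal_value w (alpha beta : 'I_k -> R) (opt : R) : Prop :=
  exists2 p, optimal_solution w alpha beta p & objective w alpha beta p = opt.

End Network.

(* Main.v *)
(** If [v] lies in [S] and [s = #|S|], then in every layer the value of [S] is
    at most the mean of the value of [S :\ v] (weight [(s - 1) / s]) and of
    [alpha i * d_i(v) + beta i] (weight [1 / s]).  The latter is smaller than
    the expected value of the optimal [p] itself, so replacing [S] in [p] by
    the mixture of [S :\ v] and [p] with these weights strictly improves every
    layer. *)
Require Import Defs.
From mathcomp Require Import all_boot all_order all_algebra.
From mathcomp Require Import reals.
From mathcomp Require Import ring lra.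

Set Implicit Arguments.
Unset Strict Implicit.
Unset Printing Implicit Defensive.

Import Order.TTheory GRing.Theory Num.Theory.
Local Open Scope ring_scope.

Lemma layer_min_le (R : realType) (V : finType) (k : nat) (G : network V k)
    (f : 'I_k -> R) (i : 'I_k) : layer_min G f <= f i.
Proof. by apply: bigmin_le_cond. Qed.

Lemma lt_layer_min (R : realType) (V : finType) (k : nat) (G : network V k)
    (f : 'I_k -> R) (x : R) : (forall i, x < f i) -> x < layer_min G f.
Proof. by move=> xf; apply/bigmin_gtP; split. Qed.

Lemma le_layer_max (R : realType) (V : finType) (k : nat) (G : network V k)
    (f : 'I_k -> R) (i : 'I_k) : f i <= layer_max G f.
Proof. by apply: le_bigmax_cond. Qed.

Section Weights.
Variables (R : realType) (V : finType) (k : nat) (G : network V k).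
Variable w : 'I_k -> {set V} -> R.
Hypothesis hw : positive_weights G w.

Lemma weight0 i : weight G w i set0 = 0.
Proof.
apply: big1 => e; rewrite inE subset0 => /andP[/edges_card2 + /eqP e0].
by rewrite e0 cards0.
Qed.

(** The empty set is covered because it induces no edge; this matters for [S :\ v] when [S] is the
    singleton of [v]. *)
Lemma card_mul_density i (S : {set V}) : #|S|%:R * density G w i S = weight G w i S.
Proof.
have [->|S0] := eqVneq S set0; first by rewrite cards0 mul0r weight0.
by rewrite mulrC divfK // pnatr_eq0 cards_eq0.
Qed.

(** Edges inside [S] that avoid [v] are exactly those induced by [S :\ v]. The others are counted in
    the degree of [v], whose remaining edges leave [S] and have positive weight. *)
Lemma weight_le_setD1 i S v :
  weight G w i S <= weight G w i (S :\ v) + degree G w i v.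
Proof.
rewrite /weight /degree (bigID (fun e : {set V} => v \in e)) /= addrC.
apply: lerD.
  rewrite le_eqVlt; apply/orP; left; apply/eqP; apply: eq_bigl => e.
  by rewrite !inE subsetD1 -andbA.
rewrite big_mkcond [leRHS]big_mkcond; apply: ler_sum => e _.
rewrite inE; case: (boolP (e \in edges G i)) => [eE|] //=.
case: (v \in e); rewrite ?andbT ?andbF //; case: (e \subset S) => //.
exact: ltW (hw eE).
Qed.

(** The mean inequality scaled by [#|S|], so that no division remains; the copies of [beta i]
    balance since [#|S| = #|S :\ v| + 1]. *)
Lemma value_le_setD1 (alpha beta : 'I_k -> R) i (S : {set V}) v :
    0 <= alpha i -> v \in S ->
  #|S|%:R * (alpha i * density G w i S + beta i) <=
  #|S :\ v|%:R * (alpha i * density G w i (S :\ v) + beta i)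
    + (alpha i * degree G w i v + beta i).
Proof.
move=> a0 vS; rewrite !mulrDr !(mulrCA _ (alpha i)) !card_mul_density.
have := ler_wpM2l a0 (weight_le_setD1 i S v).
have -> : #|S|%:R = #|S :\ v|%:R + 1 :> R by rewrite (cardsD1 v S) vS natrD addrC.
rewrite mulrDr; lra.
Qed.

End Weights.

Lemma sum_indicator_mul (R : realType) (T : finType) (a : T) (f : T -> R) :
  \sum_x (x == a)%:R * f x = f a.
Proof.
rewrite (bigD1 a) //= eqxx mul1r big1 ?addr0 // => x /negPf ->.
by rewrite mul0r.
Qed.

Section Replacement.
Variables (R : realType) (V : finType) (p : {ffun {set V} -> R}).
Variables (S T : {set V}) (t : R).

(* [S] is replaced in [p] by the mixture [(1 - t) T + t p]. *)
Definition replace : {ffun {set V} -> R} :=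
  [ffun X => p X + p S * ((1 - t) * (X == T)%:R + t * p X - (X == S)%:R)].

Lemma expectation_replace f :
  expectation replace f = expectation p f
    + p S * ((1 - t) * f T + t * expectation p f - f S).
Proof.
rewrite /expectation -(sum_indicator_mul T f) -(sum_indicator_mul S f).
rewrite !mulr_sumr -!big_split -sumrB mulr_sumr -big_split /=.
by apply: eq_bigr => X _; rewrite ffunE; ring.
Qed.

Lemma distribution_replace : 0 <= t <= 1 ->
  distribution p -> distribution replace.
Proof.
move=> /andP[t0 t1] [p0 p1].
(* Total mass is the expectation of the constant 1, for which the correction term of
   [expectation_replace] vanishes. *)
have sumE (q : {ffun {set V} -> R}) : \sum_X q X = expectation q (fun=> 1).
  by apply: eq_bigr => X _; rewrite mulr1.
split=> [X|]; last first.
  by rewrite sumE expectation_replace -sumE p1; ring.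
(* The only negative contribution is [- p S] at [X = S], where it cancels [p X]. *)
rewrite ffunE mulrBr addrCA; set y := _ * (_ + _).
have y0 : 0 <= y.
  by rewrite mulr_ge0 // addr_ge0 // mulr_ge0 // ?subr_ge0.
rewrite addr_ge0 //; case: (eqVneq X S) => [->|_].
  by rewrite mulr1 subrr.
by rewrite mulr0 subr0.
Qed.

End Replacement.

Theorem theorem6p2 (R : realType) (V : finType) (k : nat) (G : network V k)
    (w : 'I_k -> {set V} -> R) (hw : positive_weights G w)
    (alpha beta : 'I_k -> R) (halpha : forall i, 0 <= alpha i)
    (opt : R) (hopt : optimal_value G w alpha beta opt)
    (ell : R) (hell : ell <= opt)
    (v : V) (hv : layer_max G (fun i => alpha i * degree G w i v + beta i) < ell)
    (p : {ffun {set V} -> R}) (hp : optimal_solution G w alpha beta p) :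
  forall S : {set V}, S \in supp p -> v \notin S.
Proof.
move=> S; rewrite inE => pS; apply/negP => vS.
case: hopt => p' [dp' _] p'opt; case: hp => dp pmax.
(* [p] does at least as well as the solution [p'] that attains [opt]. *)
have ell_le : ell <= objective G w alpha beta p.
  by apply: le_trans hell _; rewrite -p'opt pmax.
have s0 : 0 < #|S|%:R :> R by rewrite ltr0n; apply/card_gt0P; exists v.
have s1 : 1 <= #|S|%:R :> R by rewrite ler1n -(ltr0n R).
pose t : R := #|S|%:R^-1.
have t01 : 0 <= t <= 1 by rewrite invr_ge0 ltW //= invf_le1.
have := pmax _ (distribution_replace S (S :\ v) t01 dp).
apply/negP; rewrite -ltNge; apply: lt_layer_min => i.
rewrite expectation_replace.
set f := fun X => _; set E := expectation p f.
have objE : objective G w alpha beta p <= E.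
  exact: (layer_min_le G (fun i => expectation p
    (fun X => alpha i * density G w i X + beta i)) i).
(* Since [p S > 0], the gain in layer [i] has the sign of the bracket in [expectation_replace]. *)
apply: le_lt_trans objE _; rewrite ltrDl mulr_gt0 //.
have cE : alpha i * degree G w i v + beta i < E.
  apply: le_lt_trans (lt_le_trans hv (le_trans ell_le _)).
    exact: (le_layer_max G (fun i => alpha i * degree G w i v + beta i) i).
  exact: (layer_min_le G (fun i => expectation p
    (fun X => alpha i * density G w i X + beta i)) i).
have := value_le_setD1 hw beta (halpha i) vS.
have -> : #|S :\ v|%:R = #|S|%:R - 1 :> R.
  by rewrite (cardsD1 v S) vS natrD addrAC subrr add0r.
rewrite -/(f S) -/(f (S :\ v)) => fS.
(* Scaling by [#|S|] clears [t]; what remains is [fS] with its degree term replaced by the strictly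
   larger [E]. *)
rewrite -(pmulr_rgt0 _ s0).
have -> : #|S|%:R * ((1 - t) * f (S :\ v) + t * E - f S) =
    (#|S|%:R - 1) * f (S :\ v) + E - #|S|%:R * f S.
  by rewrite /t; field; rewrite gt_eqF.
lra.
Qed.
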